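(* Let $F:\mathbb{R}^n\to\mathbb{R}$ be convex, let $x^1\in\mathbb{R}^n$, $\rho>0$ and $\beta\in(0,1)$. Suppose that $F$ has a unique minimum point $x^*$ and that there is a constant $\alpha>0$ with $$F(x)-F(x^* )\ge \alpha\|x-x^*\|^2\quad\text{for all } x\in\mathbb{R}^n \text{ with } F(x)\le F(x^1).$$ Then the bundle method, in either of its two versions (with multiple cuts or with cut aggregation), achieves solution accuracy $\varepsilon$ in at most $\mathcal{O}\big(\frac1\varepsilon\ln\frac1\varepsilon\big)$ iterations. Precisely: there exist constants $K,K'>0$ and $\varepsilon_0\in(0,1)$, depending only on $F,x^1,\alpha,\rho,\beta$ (not on $\varepsilon$, nor on the choices of subgradients and index sets made by the method), such that for every $\varepsilon\in(0,\varepsilon_0]$ the method run with stopping precision $\varepsilon$ stops at Step 2 after a total number of iterations (descent steps plus null steps) of at most $\frac{K}{\varepsilon}\ln\frac1\varepsilon$, and the point $x^k$ at which it stops satisfies $F(x^k)-F(x^* )\le K'\varepsilon$.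
   Context: $\langle\cdot,\cdot\rangle$ and $\|\cdot\|$ are the usual scalar product and the Euclidean norm on $\mathbb{R}^n$; $\partial F(z)$ is the convex subdifferential. The bundle method. Data: a convex $F:\mathbb{R}^n\to\mathbb{R}$, a starting point $x^1$, parameters $\rho>0$, $\beta\in(0,1)$, and stopping precision $\varepsilon>0$. Start with $k=1$, $z^1=x^1$ and some $g^1\in\partial F(z^1)$. At iteration $k$ a piecewise linear convex lower approximation $\widetilde F^k\le F$ is available (defined below). Step 1: let $z^{k+1}$ be the (unique) solution of $\min_x\{\widetilde F^k(x)+\frac\rho2\|x-x^k\|^2\}$. Step 2: if $F(x^k)-\widetilde F^k(z^{k+1})\le\varepsilon$ (stopping test), stop; otherwise continue. Step 3: if $F(z^{k+1})\le F(x^k)-\beta\big(F(x^k)-\widetilde F^k(z^{k+1})\big)$, set $x^{k+1}=z^{k+1}$ (descent step); otherwise set $x^{k+1}=x^k$ (null step). Step 4: choose some $g^{k+1}\in\partial F(z^{k+1})$, update the approximation to $\widetilde F^{k+1}$, increase $k$ by 1 and go to Step 1. Version with multiple cuts: $\widetilde F^k(x)=\max_{j\in J_k}\{F(z^j)+\langle g^j,x-z^j\rangle\}$ with $J_1=\{1\}$, and at Step 4 $J_{k+1}$ is any set with $J_k\cup\{k+1\}\supseteq J_{k+1}\supseteq\{k+1\}\cup\{j\in J_k: F(z^j)+\langle g^j,z^{k+1}-z^j\rangle=\widetilde F^k(z^{k+1})\}$. Version with cut aggregation: $\widetilde F^k(x)=\max\{\bar F^k(x),F(z^k)+\langle g^k,x-z^k\rangle\}$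 with $\bar F^1\equiv-\infty$, and at Step 4 $\bar F^{k+1}(x)=\theta_k\bar F^k(x)+(1-\theta_k)[F(z^k)+\langle g^k,x-z^k\rangle]$ (with $0\cdot(-\infty)=0$), where $\theta_k\in[0,1]$ is such that the gradient of $\bar F^{k+1}$ equals the subgradient $s^{k+1}=-\rho(z^{k+1}-x^k)$ of $\widetilde F^k$ at $z^{k+1}$ appearing in the optimality conditions of the Step 1 problem, so that $\bar F^{k+1}(x)=\widetilde F^k(z^{k+1})+\langle s^{k+1},x-z^{k+1}\rangle$. *)

(* Defs.v *)
From mathcomp Require Import all_boot all_order all_algebra.
From mathcomp Require Import finmap.
From mathcomp Require Import all_classical all_reals all_analysis.

Set Implicit Arguments.
Unset Strict Implicit.
Unset Printing Implicit Defensive.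

Import Order.TTheory GRing.Theory Num.Theory.

Local Open Scope ring_scope.

(* The norm that MathComp-Analysis puts on row vectors is the sup norm, hence
   the explicit Euclidean structure. *)
Definition dot (R : realType) (n : nat) (u v : 'rV[R]_n) : R :=
  \sum_(i < n) u 0 i * v 0 i.

Definition enorm (R : realType) (n : nat) (u : 'rV[R]_n) : R :=
  Num.sqrt (dot u u).

Definition subdifferential (R : realType) (n : nat) (F : 'rV[R]_n -> R)
    (z : 'rV[R]_n) : set 'rV[R]_n :=
  [set g | forall y, F z + dot g (y - z) <= F y].

Definition is_minimizer (V : Type) (d : Order.disp_t) (T : porderType d)
    (f : V -> T) (v : V) : Prop :=
  forall w, (f v <= f w)%O.

Definition cutting_plane (R : realType) (n : nat) (F : 'rV[R]_n -> R)
    (z g : nat -> 'rV[R]_n) (j : nat) (x : 'rV[R]_n) : R :=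
  F (z j) + dot (g j) (x - z j).

(* Iterations, and the sequences x, z, g, J, theta, are numbered from 0: index
   k below stands for index k + 1 when counting from 1.  The lower
   approximations [model k] take values in \bar R because the aggregate cut is
   initially -oo.  A run is given by total sequences, of which only the part up
   to the first success of the stopping test is constrained. *)
Section BundleMethod.
Context (R : realType) (n : nat).
Implicit Types (F : 'rV[R]_n -> R) (model : nat -> 'rV[R]_n -> \bar R).
Implicit Types (x z g : nat -> 'rV[R]_n) (k : nat).

Local Open Scope ereal_scope.

Definition gap F model x z k : \bar R := (F (x k))%:E - model k (z k.+1).

Definition stop_test F (eps : R) model x z k : bool :=
  gap F model x z k <= eps%:E.

(* Iteration k is entered: the test failed at all the earlier iterations. *)
Definition reached F (eps : R) model x z k : Prop :=
  forall i, (i < k)%N -> ~~ stop_test F eps model x z i.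

Definition stops_at F (eps : R) model x z k : Prop :=
  reached F eps model x z k /\ stop_test F eps model x z k.

Definition prox_objective (rho : R) model x k (y : 'rV[R]_n) : \bar R :=
  model k y + (rho / 2 * enorm (y - x k) ^+ 2)%:E.

Definition descent_test F (beta : R) model x z k : bool :=
  (F (z k.+1))%:E <= (F (x k))%:E - beta%:E * gap F model x z k.

(* What the two versions of the method have in common. *)
Record bundle_steps F (x1 : 'rV[R]_n) (rho beta eps : R) model x z g : Prop :=
  BundleSteps {
    bundle_x0 : x 0%N = x1;
    bundle_z0 : z 0%N = x1;
    bundle_g0 : subdifferential F (z 0%N) (g 0%N);
    bundle_prox : forall k, reached F eps model x z k ->
      is_minimizer (prox_objective rho model x k) (z k.+1);
    bundle_center : forall k, reached F eps model x z k.+1 ->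
      x k.+1 = if descent_test F beta model x z k then z k.+1 else x k;
    bundle_subgrad : forall k, reached F eps model x z k.+1 ->
      subdifferential F (z k.+1) (g k.+1) }.

Definition multicut_model F z g (J : nat -> {fset nat}) k (x : 'rV[R]_n) :
    \bar R :=
  \big[maxe/-oo]_(j <- J k) (cutting_plane F z g j x)%:E.

Record multicut_run F (x1 : 'rV[R]_n) (rho beta eps : R) x z g
    (J : nat -> {fset nat}) : Prop := MulticutRun {
  multicut_steps :
    bundle_steps F x1 rho beta eps (multicut_model F z g J) x z g;
  multicut_J0 : J 0%N = [fset 0%N]%fset;
  multicut_J_sup : forall k,
    reached F eps (multicut_model F z g J) x z k.+1 ->
    (J k.+1 `<=` J k `|` [fset k.+1])%fset;
  multicut_J_sub : forall k,
    reached F eps (multicut_model F z g J) x z k.+1 ->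
    ([fset k.+1] `|` [fset j in J k |
        (cutting_plane F z g j (z k.+1))%:E == multicut_model F z g J k (z k.+1)]
      `<=` J k.+1)%fset }.

(* Multiplication on \bar R satisfies 0 * -oo = 0. *)
Fixpoint aggregate F z g (theta : nat -> R) k (x : 'rV[R]_n) : \bar R :=
  if k is k'.+1 then
    (theta k')%:E * aggregate F z g theta k' x
    + (1 - theta k')%:E * (cutting_plane F z g k' x)%:E
  else -oo.

Definition aggregate_model F z g (theta : nat -> R) k (x : 'rV[R]_n) : \bar R :=
  maxe (aggregate F z g theta k x) (cutting_plane F z g k x)%:E.

Definition prox_subgradient (rho : R) x z k : 'rV[R]_n :=
  (- rho *: (z k.+1 - x k))%R.

(* [aggregate_theta] says that the new aggregate is the affine function with
   gradient s and the value of the model at z k.+1.  The gradient alone would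
   leave theta free when the old aggregate and the last cut are parallel. *)
Record aggregate_run F (x1 : 'rV[R]_n) (rho beta eps : R) x z g
    (theta : nat -> R) : Prop := AggregateRun {
  aggregate_steps :
    bundle_steps F x1 rho beta eps (aggregate_model F z g theta) x z g;
  aggregate_theta_itv : forall k,
    reached F eps (aggregate_model F z g theta) x z k.+1 ->
    (0 <= theta k <= 1)%R;
  aggregate_theta : forall k,
    reached F eps (aggregate_model F z g theta) x z k.+1 ->
    forall y, aggregate F z g theta k.+1 y =
      aggregate_model F z g theta k (z k.+1)
      + (dot (prox_subgradient rho x z k) (y - z k.+1)%R)%:E }.

End BundleMethod.

(* Main.v *)
Require Import Defs.
From mathcomp Require Import all_boot all_order all_algebra.
From mathcomp Require Import finmap.
From mathcomp Require Import all_classical all_reals all_analysis.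
From mathcomp Require Import ring lra.

Import Order.TTheory GRing.Theory Num.Theory.

Local Open Scope ring_scope.

(** Write f k for F (x k) - F xstar and let v k, the prox gap, be F (x k) minus
    the optimal value of the proximal problem of iteration k; delta k is the gap
    tested for stopping. Four facts carry the proof.

    - delta k / 2 <= v k <= delta k as long as the method goes on, so that
      v k > eps / 2 ([decrease_le_prox_gap], [prox_gap_le_decrease]).
    - The growth condition makes v k at least a constant c times f k
      ([prox_gap_ge_suboptimality]). Hence a descent step multiplies f k by at
      most 1 - beta * c, there are O(ln (1 / eps)) descent steps, and at the
      stop f k <= eps / c ([descent_contraction], [stopping_accuracy]).
    - At a null step the next model lies above both the aggregate of the current
      one and a cut that exceeds the current model by more than
      (1 - beta) * delta k at z k.+1. Balancing the two gives
      v k.+1 <= v k - gamma * delta k ^ 2, so that 1 / v k grows by at least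
      gamma ([prox_gap_null_step], [inverse_prox_gap_null]). As 1 / v k stays
      below 2 / eps, at most O(1 / eps) null steps follow each other.
    - The constant gamma is uniform because all centers lie in a bounded level
      set, the trial points stay within a fixed distance of it, and the
      subgradients of a finite convex function over a bounded set are bounded
      ([subgradient_bounded], [prox_gap_bounded]).

    A counting argument multiplies the two bounds ([iteration_count]). The two
    versions of the method enter only through three inequalities on their
    models, collected in [lower_model_run]. *)

(** * The Euclidean scalar product *)

Section ScalarProduct.
Context {R : realType} {n : nat}.
Implicit Types (u v w : 'rV[R]_n) (a : R).

Lemma dotC u v : dot u v = dot v u.
Proof. by apply: eq_bigr => i _; rewrite mulrC. Qed.

Lemma dotDl u v w : dot (u + v) w = dot u w + dot v w.
Proof. by rewrite -big_split; apply: eq_bigr => i _; rewrite mxE mulrDl. Qed.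

Lemma dotZl a u w : dot (a *: u) w = a * dot u w.
Proof. by rewrite mulr_sumr; apply: eq_bigr => i _; rewrite mxE mulrA. Qed.

Lemma dotDr u v w : dot w (u + v) = dot w u + dot w v.
Proof. by rewrite dotC dotDl !(dotC w). Qed.

Lemma dotZr a u w : dot w (a *: u) = a * dot w u.
Proof. by rewrite dotC dotZl (dotC w). Qed.

Lemma dotNl u w : dot (- u) w = - dot u w.
Proof. by rewrite -scaleN1r dotZl mulN1r. Qed.

Lemma dotNr u w : dot w (- u) = - dot w u.
Proof. by rewrite dotC dotNl (dotC w). Qed.

Definition dotE := (dotDl, dotDr, dotZl, dotZr, dotNl, dotNr).

Lemma dot_ge0 u : 0 <= dot u u.
Proof. by apply: sumr_ge0 => i _; rewrite -expr2 sqr_ge0. Qed.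

Lemma sqr_coord_le_dot u i : u 0 i ^+ 2 <= dot u u.
Proof.
rewrite /dot (bigD1 i)//= -expr2 lerDl.
by apply: sumr_ge0 => j _; rewrite -expr2 sqr_ge0.
Qed.

Lemma enorm_sqr u : enorm u ^+ 2 = dot u u.
Proof. by rewrite sqr_sqrtr ?dot_ge0. Qed.

(** The left-hand side is the minimum over v of the right-hand side, in other
    words the optimal value of a proximal problem with a single cut. *)
Lemma dot_young {a} u v : 0 < a ->
  - dot u u / (2 * a) <= dot u v + a / 2 * dot v v.
Proof.
move=> a0; have := dot_ge0 (u + a *: v); rewrite !dotE (dotC v u) => h.
rewrite -subr_ge0.
rewrite (_ : _ - _ = (dot u u + a * dot u v + a * (dot u v + a * dot v v)) /
  (2 * a)); last by field; rewrite gt_eqF.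
by apply: divr_ge0; lra.
Qed.

Lemma dot_add_le u v : dot (u + v) (u + v) <= 2 * dot u u + 2 * dot v v.
Proof. have := dot_ge0 (u - v); rewrite !dotE (dotC v u); lra. Qed.

End ScalarProduct.

(** * Bounded subgradients of a convex function *)

Section LocallyBounded.
Context {R : realType} {n : nat} {F : 'rV[R]_n -> R}.
Hypothesis F_convex : convex_function (E := 'rV[R]_n) setT F.

Lemma convex_segment (t : R) (x y : 'rV[R]_n) : 0 <= t <= 1 ->
  F (t *: x + (1 - t) *: y) <= t * F x + (1 - t) * F y.
Proof.
move=> t01.
have @p : {i01 R} by exists t; rewrite /= /Itv.num_sem/= in_itv/= t01 num_real.
by apply: (F_convex p); rewrite inE.
Qed.

(** A point whose first k + 1 coordinates may be nonzero is the midpoint of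
    twice its projection on the first k coordinates and twice its component
    along the last axis, and the latter lies on a segment of that axis:
    convexity reduces the dimension by one, at the price of doubling the box. *)
Lemma convex_bounded_box (M : R) :
  exists U, forall x : 'rV[R]_n, (forall i, `|x 0 i| <= M) -> F x <= U.
Proof.
suff H k : (k <= n)%N -> forall M, exists U, forall x : 'rV[R]_n,
    (forall i, `|x 0 i| <= M) -> (forall i : 'I_n, (k <= i)%N -> x 0 i = 0) ->
    F x <= U.
  have [U HU] := H n (leqnn n) M; exists U => x Hx; apply: HU => // i.
  by rewrite leqNgt ltn_ord.
elim: k => [|k IH] kn {}M.
  exists (F 0) => x _ x0; rewrite (_ : x = 0)//.
  by apply/rowP => i; rewrite x0// mxE.
have [U HU] := IH (ltnW kn) (2 * M).
pose e : 'rV[R]_n := delta_mx 0 (Ordinal kn).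
pose N := 2 * M + 1.
exists ((`|U| + (`|F (N *: e)| + `|F (- N *: e)|)) / 2) => x xM x0.
have M0 : 0 <= M by apply: le_trans (xM (Ordinal kn)).
pose c := x 0 (Ordinal kn).
pose y : 'rV[R]_n := \row_i (if i == Ordinal kn then 0 else 2 * x 0 i).
have yU : F y <= U.
  apply: HU => i; rewrite mxE.
    case: eqVneq => _; first by rewrite normr0; lra.
    by rewrite normrM ger0_norm// ler_pM2l.
  case: eqVneq => // ik ki; rewrite x0 ?mulr0// ltn_neqAle ki andbT.
  by apply: contra ik => /eqP ik; apply/eqP/val_inj.
have [c1 c2] : - M <= c /\ c <= M by apply/andP; rewrite -ler_norml xM.
have N0 : 0 < N by rewrite /N; lra.
(* The weight that writes 2 * c as a point of the segment from - N to N. *)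
pose t := (2 * c + N) / (2 * N).
have t01 : 0 <= t <= 1.
  by rewrite divr_ge0 ?ler_pdivrMr; rewrite /N; lra.
have /convex_segment h : 0 <= (1/2 : R) <= 1 by lra.
have := h y ((2 * c) *: e).
rewrite (_ : _ + _ = x); last first.
  apply/rowP => i; rewrite !mxE /=; case: eqVneq => [->|_].
    by rewrite -/c mulr1n; field.
  by rewrite mulr0n; field.
have := convex_segment t (N *: e) (- N *: e) t01.
rewrite !scalerA -scalerDl (_ : t * N + _ = 2 * c); last first.
  by rewrite /t; field; rewrite gt_eqF.
have := ler_norm U; have := ler_norm (F (N *: e)).
have := ler_norm (F (- N *: e)); have := normr_ge0 (F (- N *: e)).
have := normr_ge0 (F (N *: e)); case/andP: t01; nra.
Qed.

Lemma convex_bounded_ball (D : R) :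
  exists U, forall x : 'rV[R]_n, dot x x <= D -> F x <= U.
Proof.
have [U HU] := convex_bounded_box (D + 1).
exists U => x xD; apply: HU => i; have := sqr_coord_le_dot x i.
have := normr_ge0 (x 0 i); rewrite -normr_id -(real_normK (num_real (x 0 i))).
rewrite normr_id; have := dot_ge0 x; nra.
Qed.

(** A unit step from z in the direction of g raises F by at least the norm of g,
    while F is bounded below by its minimum and above near the ball. *)
Lemma subgradient_bounded (xstar : 'rV[R]_n) (D : R) : is_minimizer F xstar ->
  exists2 G, 0 <= G & forall z g, dot (z - xstar) (z - xstar) <= D ->
    subdifferential F z g -> dot g g <= G.
Proof.
move=> Fmin.
have [U HU] := convex_bounded_ball (2 * (2 * D + 2 * dot xstar xstar) + 2).
exists ((U - F xstar) ^+ 2) => [|z g zD sub]; first exact: sqr_ge0.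
pose N := enorm g; have N0 : 0 <= N by apply: sqrtr_ge0.
rewrite -enorm_sqr -/N; have [->|gN0] := eqVneq N 0.
  by rewrite expr0n sqr_ge0.
have {}N0 : 0 < N by rewrite lt_neqAle eq_sym gN0.
suff NU : N <= U - F xstar.
  have N0w := ltW N0; rewrite lerXn2r ?nnegrE//.
  exact: le_trans NU.
have gg1 : dot (N^-1 *: g) (N^-1 *: g) = 1.
  by rewrite !dotE -enorm_sqr -/N; field.
have := sub (z + N^-1 *: g); rewrite (addrC z) addrK dotZr -enorm_sqr -/N.
rewrite (_ : N^-1 * N ^+ 2 = N); last by field.
have := Fmin z.
have := dot_add_le (N^-1 *: g) z; have := dot_add_le (z - xstar) xstar.
rewrite subrK gg1; move=> *.
suff : F (N^-1 *: g + z) <= U by lra.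
by apply: HU; lra.
Qed.

End LocallyBounded.

(** * The models of the two versions *)

Section ActivePieces.
Context {R : realType}.

(** One-dimensional form of the optimality condition for a finite maximum of
    affine functions. If near t = 0+ the maximum of the pieces a j + t * l j
    stays above m + t * sigma up to second order, then a piece active at 0 has
    slope at least sigma: an inactive piece is too low for small t, and so is an
    active one with a smaller slope. Applied along a segment issued from the
    proximal point, it shows that the active cuts alone dominate the aggregate
    cut. *)
Lemma active_piece_slope {I : eqType} (s : seq I) (a l : I -> R) (m sigma q : R) :
  0 <= q -> (forall j, j \in s -> a j <= m) ->
  (forall t, 0 < t ->
    exists2 j, j \in s & m + t * sigma - t ^+ 2 * q <= a j + t * l j) ->
  exists2 j, j \in s & a j = m /\ sigma <= l j.
Proof.
move=> q0 am small; apply: contrapT => none.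
suff [T T0 HT] : exists2 T, 0 < T & forall j, j \in s -> forall t, 0 < t <= T ->
    a j + t * l j < m + t * sigma - t ^+ 2 * q.
  have [j js] := small T T0; have := HT j js T; lra.
have {am none} : forall j, j \in s -> a j <= m /\ (l j < sigma \/ a j < m).
  move=> j js; split; first exact: am.
  have [ls|?] := leP sigma (l j); last by left.
  right; rewrite lt_neqAle am// andbT; apply/eqP => ajm.
  by apply: none; exists j.
elim: s {small} => [|i s IH] H; first by exists 1.
have [|T T0 HT] := IH; first by move=> j js; apply: H; rewrite inE js orbT.
suff [U U0 HU] : exists2 U, 0 < U & forall t, 0 < t <= U ->
    a i + t * l i < m + t * sigma - t ^+ 2 * q.
  exists (Num.min T U) => [|j]; first by rewrite lt_min T0.
  rewrite inE => /predU1P[->|js] t; rewrite le_min => /and3P[t0 tT tU].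
    by apply: HU; rewrite t0.
  by apply: HT => //; rewrite t0.
have [am [ls|lt_am]] := H i (mem_head _ _).
  exists ((sigma - l i) / (q + 1)); first by rewrite divr_gt0; lra.
  move=> t /andP[t0]; rewrite ler_pdivlMr; last by lra.
  rewrite -subr_ge0 => /(mulr_ge0 (ltW t0)).
  by have := mulr_gt0 t0 t0; lra.
exists (Num.min 1 ((m - a i) / (`|l i - sigma| + q + 1))).
  by rewrite lt_min ltr01 divr_gt0; have := normr_ge0 (l i - sigma); lra.
move=> t; rewrite le_min => /and3P[t0 t1].
have := normr_ge0 (l i - sigma); have := ler_norm (l i - sigma).
move=> h1 h2; rewrite ler_pdivlMr; last by lra.
rewrite -subr_ge0 in h1.
have := mulr_ge0 (ltW t0) h1.
have := mulr_ge0 q0 (mulr_ge0 (ltW t0) (_ : 0 <= 1 - t)).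
by rewrite subr_ge0 => /(_ t1); lra.
Qed.

End ActivePieces.

Section BigMax.
Context {R : realType} {I : eqType}.
Implicit Types (s : seq I) (f : I -> R).

Lemma le_bigmaxe {s} f {j} : j \in s ->
  ((f j)%:E <= \big[maxe/-oo]_(i <- s) (f i)%:E)%E.
Proof.
elim: s => // i s IH; rewrite inE big_cons le_max => /predU1P[->|/IH->].
  by rewrite lexx.
by rewrite orbT.
Qed.

Lemma bigmaxe_attained {s} f {i} : i \in s ->
  exists2 j, j \in s & (\big[maxe/-oo]_(i <- s) (f i)%:E)%E = (f j)%:E.
Proof.
elim: s i => // i [|k s] IH _ _.
  by exists i; rewrite ?mem_head// big_seq1.
have [|j js E] := IH k; first exact: mem_head.
rewrite big_cons E; case: (leP (f i)%:E (f j)%:E) => _; last first.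
  by exists i; rewrite ?mem_head.
by exists j; rewrite // inE js orbT.
Qed.

End BigMax.

Section ModelProperties.
Context {R : realType} {n : nat}.
Implicit Types (F : 'rV[R]_n -> R) (model : nat -> 'rV[R]_n -> \bar R).
Implicit Types (x z g : nat -> 'rV[R]_n) (k : nat).

(** What the complexity analysis needs to know of the models: they contain the
    latest cut, they are minorants of F, and each one dominates the aggregate
    affine function built from its predecessor at the proximal point. *)
Record lower_model_run F (rho eps : R) model x z g : Prop := LowerModelRun {
  cut_le_model : forall k, reached F eps model x z k -> forall y,
    ((cutting_plane F z g k y)%:E <= model k y)%E;
  model_le : forall k, reached F eps model x z k -> forall y,
    (model k y <= (F y)%:E)%E;
  aggregate_le_model : forall k, reached F eps model x z k.+1 -> forall y,
    (model k (z k.+1) + (dot (prox_subgradient rho x z k) (y - z k.+1))%:E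
       <= model k.+1 y)%E }.

Lemma reachedS {F eps model x z k} : reached F eps model x z k.+1 ->
  reached F eps model x z k.
Proof. by move=> r i ik; apply: r; rewrite ltnW. Qed.

Lemma reached_le {F eps model x z j k} : (j <= k)%N ->
  reached F eps model x z k -> reached F eps model x z j.
Proof. by move=> jk r i ij; apply: r; exact: leq_trans jk. Qed.

Lemma bundle_step_subgradient {F} {x1 : 'rV[R]_n} {rho beta eps model x z g} :
  bundle_steps F x1 rho beta eps model x z g ->
  forall k, reached F eps model x z k -> subdifferential F (z k) (g k).
Proof. by move=> S [_|k /(bundle_subgrad S)//]; exact: (bundle_g0 S). Qed.

Lemma cutting_plane_line F z g j (y w : 'rV[R]_n) (t : R) :
  cutting_plane F z g j (w + t *: (y - w)) =
  cutting_plane F z g j w + t * dot (g j) (y - w).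
Proof. by rewrite /cutting_plane (addrAC w) [in LHS]dotDr dotZr addrA. Qed.

(** The aggregate function is not itself among the cuts that are kept, but by
    [active_piece_slope] at each point y it is dominated there by one of the
    cuts that are active at z k.+1, and these are kept. *)
Lemma multicut_lower_model {F} {x1 : 'rV[R]_n} {rho beta eps x z g J} :
  0 < rho ->
  multicut_run F x1 rho beta eps x z g J ->
  lower_model_run F rho eps (multicut_model F z g J) x z g.
Proof.
move=> rho0 [S J0 Jsup Jsub].
have Jk k : reached F eps (multicut_model F z g J) x z k ->
    k \in J k /\ forall j, j \in J k -> (j <= k)%N.
  elim: k => [_|k IH r].
    by rewrite J0; split=> [|j]; rewrite inE// => /eqP->.
  have [_ IHk] := IH (reachedS r); split.
    by apply: (fsubsetP (Jsub k r)); rewrite !inE eqxx.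
  move=> j /(fsubsetP (Jsup k r)); rewrite !inE => /orP[/IHk/leqW//|/eqP->//].
split=> k r y.
- by apply: (le_bigmaxe (cutting_plane F z g ^~ y)); have [] := Jk k r.
- have [kJ Jle] := Jk k r.
  have [j jJ E] := bigmaxe_attained (cutting_plane F z g ^~ y) kJ.
  rewrite /multicut_model E lee_fin.
  by apply: (bundle_step_subgradient S); apply: reached_le r; exact: Jle.
have rk := reachedS r.
have [kJ _] := Jk k rk.
pose w := z k.+1.
have [i iJ Ew] := bigmaxe_attained (cutting_plane F z g ^~ w) kJ.
set m := cutting_plane F z g i w in Ew.
have [||t t0|j jJ [jm jl]] := active_piece_slope (J k)
  (cutting_plane F z g ^~ w)
  (fun j => dot (g j) (y - w)) m (dot (prox_subgradient rho x z k) (y - w))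
  (rho / 2 * dot (y - w) (y - w)).
- by rewrite mulr_ge0 ?dot_ge0//; lra.
- move=> j jJ; rewrite -lee_fin -Ew.
  exact: (le_bigmaxe (cutting_plane F z g ^~ w)).
- pose wt := w + t *: (y - w).
  have [j jJ Ej] := bigmaxe_attained (cutting_plane F z g ^~ wt) kJ.
  exists j => //; have := bundle_prox S rk wt.
  rewrite /prox_objective /multicut_model Ew Ej -!EFinD lee_fin !enorm_sqr.
  rewrite /wt cutting_plane_line (addrAC w) /prox_subgradient -/w.
  by move: (w - x k) (y - w) => c d; rewrite !dotE (dotC d c); lra.
have jJ' : j \in J k.+1.
  apply: (fsubsetP (Jsub k r)); rewrite !inE jJ /=.
  by rewrite -/w jm /multicut_model Ew eqxx orbT.
apply: le_trans (le_bigmaxe (cutting_plane F z g ^~ y) jJ').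
rewrite /multicut_model -/w Ew -EFinD lee_fin -jm -[X in _ <= X]addr0.
have := cutting_plane_line F z g j y w 1; rewrite scale1r addrC subrK => ->; lra.
Qed.

(** The weights theta are used to see that the aggregate is a minorant of F,
    being a convex combination of minorants; its expression as an affine
    function with slope s gives the last property. *)
Lemma aggregate_lower_model {F} {x1 : 'rV[R]_n} {rho beta eps x z g theta} :
  aggregate_run F x1 rho beta eps x z g theta ->
  lower_model_run F rho eps (aggregate_model F z g theta) x z g.
Proof.
move=> [S th01 agg].
have cutF k y : reached F eps (aggregate_model F z g theta) x z k ->
    ((cutting_plane F z g k y)%:E <= (F y)%:E)%E.
  by move=> r; rewrite lee_fin; exact: (bundle_step_subgradient S).
have aggF k y : reached F eps (aggregate_model F z g theta) x z k ->
    (aggregate F z g theta k y <= (F y)%:E)%E.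
  elim: k => [_|k IH r]; first exact: leNye.
  have rk := reachedS r; have /andP[th0 th1] := th01 k r.
  rewrite /= (_ : (F y)%:E = (theta k)%:E * (F y)%:E + (1 - theta k)%:E * (F y)%:E)%E.
    by apply: leeD; apply: lee_wpmul2l; rewrite ?lee_fin ?subr_ge0// -?lee_fin; auto.
  by rewrite -!EFinM -EFinD -mulrDl addrC subrK mul1r.
split=> k r y.
- by rewrite le_max lexx orbT.
- by rewrite ge_max aggF// cutF.
- by rewrite -agg// le_max lexx.
Qed.

End ModelProperties.

Arguments cut_le_model {R n F rho eps model x z g} _ {k} _ y.
Arguments model_le {R n F rho eps model x z g} _ {k} _ y.
Arguments aggregate_le_model {R n F rho eps model x z g} _ {k} _ y.

(** * Counting descent steps and null steps *)

Section Counting.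
Context {R : realType}.

(** Along the run, k is at most 1 / (gamma * w k) + d * B, where d is the number
    of descent steps made so far (the first alternative) and B = 1 / (gamma * e)
    + 1 bounds what a descent step can lose in 1 / (gamma * w), plus the step
    itself. Geometric decrease of f, which is at least delta before each descent
    step, bounds d. *)
Lemma iteration_count (f w : nat -> R) (N : nat) (q gamma e delta M : R) :
  0 < q < 1 -> 0 < gamma -> 0 < e -> 0 < delta -> delta <= M -> f 0%N <= M ->
  (forall k, (k <= N)%N -> e < w k) ->
  (forall k, (k < N)%N ->
     f k.+1 <= q * f k /\ delta <= f k \/
     f k.+1 <= f k /\ (w k)^-1 + gamma <= (w k.+1)^-1) ->
  N%:R <= (ln (M / delta) / - ln q + 2) * ((gamma * e)^-1 + 1).
Proof.
move=> q01 gamma0 e0 delta0 deltaM fM we step; have [q0 q1] := andP q01.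
pose B := (gamma * e)^-1 + 1.
have wB k : (k <= N)%N -> 0 < (w k)^-1 / gamma /\ (w k)^-1 / gamma + 1 <= B.
  move=> /we ew; have w0 : 0 < w k := lt_trans e0 ew.
  split; first by rewrite divr_gt0 ?invr_gt0.
  by rewrite lerD2r -invfM mulrC lef_pV2 ?posrE ?mulr_gt0// ler_pM2l// ltW.
have B0 : 0 < B by rewrite addr_gt0 ?invr_gt0 ?mulr_gt0.
have main k : (k <= N)%N -> exists d : nat,
    (* The last descent step was made from a value at least delta, whence the
       exponent d.-1. *)
    [/\ k%:R <= (w k)^-1 / gamma + d%:R * B, f k <= q ^+ d * M &
        delta <= q ^+ d.-1 * M].
  elim: k => [_|k IH kN].
    exists 0%N; rewrite mul0r addr0 expr0 mul1r; split=> //.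
    by have [/ltW] := wB 0%N (leq0n _).
  have [d [kd fd dd]] := IH (ltnW kN).
  have [w0 wk] := wB k (ltnW kN); have [w1 _] := wB k.+1 kN.
  have [[fq df]|[ff ww]] := step k kN.
    exists d.+1; split.
    - by rewrite -!natr1; lra.
    - by apply: le_trans fq _; rewrite exprS -mulrA ler_pM2l.
    - exact: le_trans df fd.
  exists d; split=> //; last exact: le_trans ff fd.
  have : (w k)^-1 / gamma + 1 <= (w k.+1)^-1 / gamma.
    have gammaV : 0 <= gamma^-1 by rewrite invr_ge0 ltW.
    by have := ler_wpM2r gammaV ww; rewrite mulrDl divff ?gt_eqF.
  by rewrite -natr1; lra.
have [d [kd _ dd]] := main N (leqnn N).
have [_ wN] := wB N (leqnn N).
apply: (@le_trans _ _ ((d%:R + 1) * B)); first by lra.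
rewrite ler_pM2r// -[2]/(1 + 1) addrA lerD2r.
have lnq : 0 < - ln q by rewrite oppr_gt0 ln_lt0.
have M0 : 0 < M := lt_le_trans delta0 deltaM.
have ln0 : 0 <= ln (M / delta) by rewrite ln_ge0// ler_pdivlMr ?mul1r.
apply: (@le_trans _ _ (d.-1%:R + 1)).
  by case: (d) => [|d'] /=; rewrite ?natr1// addr_ge0.
rewrite lerD2r ler_pdivlMr// ln_div ?posrE//.
have qd : 0 < q ^+ d.-1 by rewrite exprn_gt0.
have := dd; rewrite -ler_ln ?posrE ?mulr_gt0// lnM ?posrE// lnXn// -mulr_natl.
lra.
Qed.

End Counting.

(** * Progress made by one step *)

Section ProxGap.
Context {R : realType} {n : nat}.
Implicit Types (F : 'rV[R]_n -> R) (model : nat -> 'rV[R]_n -> \bar R).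
Implicit Types (x z g : nat -> 'rV[R]_n) (k : nat).

Definition predicted_decrease F model x z k : R :=
  F (x k) - fine (model k (z k.+1)).

(** F (x k) minus the optimal value of the proximal problem. *)
Definition prox_gap F (rho : R) model x z k : R :=
  predicted_decrease F model x z k
  - rho / 2 * dot (z k.+1 - x k) (z k.+1 - x k).

End ProxGap.

Section Run.
Context {R : realType} {n : nat}.
Context {F : 'rV[R]_n -> R} {x1 : 'rV[R]_n} {rho beta eps : R}.
Context {xstar : 'rV[R]_n} {alpha : R}.
Context {model : nat -> 'rV[R]_n -> \bar R} {x z g : nat -> 'rV[R]_n}.
Hypotheses (rho_gt0 : 0 < rho) (beta_in01 : 0 < beta < 1) (eps_gt0 : 0 < eps).
Hypotheses (F_convex : convex_function (E := 'rV[R]_n) setT F)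
  (xstar_min : is_minimizer F xstar) (alpha_gt0 : 0 < alpha)
  (growth : forall y, F y <= F x1 ->
     F y - F xstar >= alpha * enorm (y - xstar) ^+ 2).
Hypothesis steps : bundle_steps F x1 rho beta eps model x z g.
Hypothesis lower : lower_model_run F rho eps model x z g.

Let reach := reached F eps model x z.
Let pd := predicted_decrease F model x z.
Let v := prox_gap F rho model x z.
Let s := prox_subgradient rho x z.

Lemma modelE {k} y : reach k -> model k y = (fine (model k y))%:E.
Proof.
move=> r; have := cut_le_model lower r y; have := model_le lower r y.
by case: (model k y).
Qed.

Lemma gapE {k} : reach k -> gap F model x z k = (pd k)%:E.
Proof. by move=> r; rewrite /gap (modelE _ r) -EFinB. Qed.

Lemma stop_testE {k} : reach k -> stop_test F eps model x z k = (pd k <= eps).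
Proof. by move=> r; rewrite /stop_test gapE// lee_fin. Qed.

Lemma descent_testE {k} : reach k ->
  descent_test F beta model x z k = (F (z k.+1) <= F (x k) - beta * pd k).
Proof. by move=> r; rewrite /descent_test gapE// -EFinM -EFinB lee_fin. Qed.

Lemma predicted_decrease_gt {k} : reach k.+1 -> eps < pd k.
Proof.
by move=> r; rewrite ltNge -stop_testE; [exact: r | exact: reachedS r].
Qed.

Lemma prox_gap_ge {k} y : reach k ->
  F (x k) - F y - rho / 2 * dot (y - x k) (y - x k) <= v k.
Proof.
move=> r; have := bundle_prox steps r y; have := model_le lower r y.
rewrite /prox_objective (modelE y r) (modelE (z k.+1) r) -!EFinD !lee_fin !enorm_sqr.
by rewrite /v /prox_gap /predicted_decrease; lra.
Qed.

(** Evaluate at x k the aggregate function, which is a minorant of F. *)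
Lemma prox_step_le_decrease {k} : reach k.+1 ->
  rho * dot (z k.+1 - x k) (z k.+1 - x k) <= pd k.
Proof.
move=> r; have rk := reachedS r.
have := le_trans (aggregate_le_model lower r (x k)) (model_le lower r (x k)).
rewrite (modelE _ rk) -EFinD lee_fin /prox_subgradient -(opprB (z k.+1)).
by rewrite /pd /predicted_decrease !(dotNr, dotZl); lra.
Qed.

Lemma decrease_le_prox_gap {k} : reach k.+1 -> pd k <= 2 * v k.
Proof. by move=> /prox_step_le_decrease; rewrite /v /prox_gap -/pd; lra. Qed.

Lemma prox_gap_le_decrease k : v k <= pd k.
Proof.
by rewrite /v /prox_gap -/pd gerBl mulr_ge0 ?dot_ge0 ?divr_ge0// ltW.
Qed.

(** When the latest cut is taken at the center, it alone bounds the optimal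
    value of the proximal problem from below. *)
Lemma prox_gap_new_center {k} : reach k -> x k = z k ->
  v k <= dot (g k) (g k) / (2 * rho).
Proof.
move=> r xz; have := cut_le_model lower r (z k.+1).
rewrite (modelE _ r) lee_fin /cutting_plane -xz /v /prox_gap.
have := dot_young (g k) (z k.+1 - x k) rho_gt0.
by rewrite /predicted_decrease mulNr; lra.
Qed.

(** With d = z k.+2 - z k.+1, the combination with weights 1 - mu and mu of the
    aggregate and of the new cut bounds the new optimal value from below by the
    old one plus mu * (1 - beta) * pd k + mu * <g - s, d> + rho / 2 * |d|^2, and
    the sum of the last two terms is at least - mu^2 * L / (2 * rho). The weight
    mu maximizes the resulting gain; the bound rho * pd k <= L makes it at most
    one. *)
Lemma prox_gap_null_step {k} {L : R} : reach k.+1 -> x k.+1 = x k ->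
  F (x k) - beta * pd k < F (z k.+1) -> 0 < L ->
  dot (g k.+1 - s k) (g k.+1 - s k) <= L -> rho * pd k <= L ->
  v k.+1 <= v k - rho * (1 - beta) ^+ 2 / (2 * L) * pd k ^+ 2.
Proof.
move=> r xx null L0 gL pdL; have rk := reachedS r.
have pd0 : 0 < pd k := lt_trans eps_gt0 (predicted_decrease_gt r).
have := aggregate_le_model lower r (z k.+2).
have := cut_le_model lower r (z k.+2).
rewrite (modelE _ rk) (modelE _ r) -EFinD !lee_fin /cutting_plane.
rewrite {1}/v /prox_gap {1}/predicted_decrease xx.
set m' := fine (model k.+1 _); set c := z k.+1 - x k.
rewrite (_ : z k.+2 - x k = c + (z k.+2 - z k.+1)); last first.
  by rewrite /c [RHS]addrC addrA subrK.
set d := z k.+2 - z k.+1 => newcut agg.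
pose mu := rho * (1 - beta) * pd k / L.
have [mu0 mu1] : 0 <= mu /\ mu <= 1.
  have [beta0 beta1] := andP beta_in01.
  have pd0' : 0 <= rho * pd k by rewrite mulr_ge0 ?ltW.
  rewrite /mu [rho * _ * _]mulrAC; split.
    by rewrite !(mulr_ge0, invr_ge0) ?ltW// subr_gt0.
  by rewrite ler_pdivrMr//; nra.
have sE : dot (s k) d = - rho * dot c d by rewrite dotZl.
have vE : v k = pd k - rho / 2 * dot c c by [].
clearbody c d m'.
have young : - (mu ^+ 2 * L / (2 * rho)) <=
    mu * (dot (g k.+1) d - dot (s k) d) + rho / 2 * dot d d.
  have := dot_young (mu *: (g k.+1 - s k)) d rho_gt0.
  rewrite 2!dotZl dotZr [dot _ d]dotDl dotNl; apply: le_trans.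
  rewrite mulNr lerN2 ler_pM2r ?invr_gt0; last by rewrite mulr_gt0.
  by rewrite mulrA -expr2 ler_wpM2l ?sqr_ge0.
pose T := rho * (1 - beta) ^+ 2 / (2 * L) * pd k ^+ 2.
have E1 : mu ^+ 2 * L / (2 * rho) = T by rewrite /mu /T; field; rewrite !gt_eqF.
have E2 : mu * ((1 - beta) * pd k) = 2 * T by rewrite /mu /T; field; rewrite gt_eqF.
have pdE : pd k = F (x k) - fine (model k (z k.+1)) by [].
have jump : mu * ((1 - beta) * pd k) <= mu * (F (z k.+1) - fine (model k (z k.+1))).
  by apply: ler_wpM2l => //; lra.
have new' : mu * (F (z k.+1) + dot (g k.+1) d) <= mu * m' by exact: ler_wpM2l.
have agg' : (1 - mu) * (fine (model k (z k.+1)) + dot (s k) d) <= (1 - mu) * m'.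
  by apply: ler_wpM2l; lra.
rewrite vE -/T.
have -> : dot (c + d) (c + d) = dot c c + 2 * dot c d + dot d d.
  by rewrite !(dotDl, dotDr) (dotC d c); lra.
clear -E1 E2 pdE jump new' agg' young sE.
lra.
Qed.

(** The fraction of F (x k) - F xstar that the proximal problem is guaranteed to
    gain. *)
Definition growth_rate (rho alpha : R) : R := Num.min 1 (alpha / rho) / 2.
Let c := growth_rate rho alpha.

(** Move from x k towards xstar by the fraction t = min 1 (alpha / rho):
    convexity gains t * (F (x k) - F xstar), and by the growth condition the
    proximal term costs at most half of that. *)
Lemma prox_gap_ge_suboptimality {k} : reach k -> F (x k) <= F x1 ->
  c * (F (x k) - F xstar) <= v k.
Proof.
move=> r Fx; pose t := 2 * c.
have tE : t = Num.min 1 (alpha / rho) by rewrite /t /c /growth_rate; field.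
have t0 : 0 <= t by rewrite tE le_min ler01 divr_ge0// ltW.
have t1 : t <= 1 by rewrite tE ge_min lexx.
have tr : t * rho <= alpha by rewrite -ler_pdivlMr// tE ge_min lexx orbT.
have t01 : 0 <= t <= 1 by rewrite t0.
have := prox_gap_ge (t *: xstar + (1 - t) *: x k) r.
rewrite (_ : _ + _ - x k = (- t) *: (x k - xstar)); last first.
  by apply/rowP => i; rewrite !mxE; ring.
have := convex_segment F_convex t xstar (x k) t01; have := growth _ Fx.
rewrite enorm_sqr dotZl dotZr; have := dot_ge0 (x k - xstar).
move: (dot _ _) (F (_ + _)) => e Fy e0 ge Fyle.
have := mulr_ge0 (mulr_ge0 t0 e0) (_ : 0 <= alpha - t * rho).
rewrite subr_ge0 => /(_ tr) h1.
have h2 : 0 <= t * (F (x k) - F xstar - alpha * e) by rewrite mulr_ge0// subr_ge0.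
by apply: le_trans; rewrite (_ : c = t / 2); [lra | rewrite /t; field].
Qed.

Lemma center_step {k} : reach k.+1 ->
  x k.+1 = z k.+1 /\ F (x k.+1) <= F (x k) - beta * pd k \/
  x k.+1 = x k /\ F (x k) - beta * pd k < F (z k.+1).
Proof.
move=> r; rewrite (bundle_center steps r) (descent_testE (reachedS r)).
by case: leP; [left | right].
Qed.

Lemma center_monotone {k} : reach k.+1 -> F (x k.+1) <= F (x k).
Proof.
move=> r; have [[_ Fle]|[->//]] := center_step r; apply: le_trans Fle _.
rewrite gerBl mulr_ge0//; first by case/andP: beta_in01 => /ltW.
exact/ltW/(lt_trans eps_gt0)/predicted_decrease_gt.
Qed.

Lemma center_in_level_set {k} : reach k -> F (x k) <= F x1.
Proof.
elim: k => [|k IH r]; first by rewrite (bundle_x0 steps).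
exact: le_trans (center_monotone r) (IH (reachedS r)).
Qed.

Let D0 := (F x1 - F xstar) / alpha.

Lemma center_in_ball {k} : reach k -> dot (x k - xstar) (x k - xstar) <= D0.
Proof.
move=> /center_in_level_set Fx; have := growth _ Fx.
by rewrite enorm_sqr /D0 ler_pdivlMr//; lra.
Qed.

Context {V L : R}.
(* V bounds the prox gap of a new center, and L bounds the squared difference
   between a new subgradient and the slope of the aggregate. *)
Hypotheses (V_ge0 : 0 <= V) (L_gt0 : 0 < L).
Hypothesis V_bound : forall y h, dot (y - xstar) (y - xstar) <= D0 ->
  subdifferential F y h -> dot h h <= 2 * (rho * V).
Hypothesis L_bound : forall y h,
  dot (y - xstar) (y - xstar) <= 2 * (2 * V / rho) + 2 * D0 ->
  subdifferential F y h -> 2 * dot h h + 4 * (rho * V) <= L.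

Let gamma := rho * (1 - beta) ^+ 2 / (2 * L).

Lemma gamma_ge0 : 0 <= gamma.
Proof.
by rewrite divr_ge0//; [rewrite mulr_ge0 ?sqr_ge0// ltW|rewrite mulr_ge0// ltW].
Qed.

Lemma prox_gap_null_decrease {k} : reach k.+1 -> v k <= V ->
  x k.+1 = x k -> F (x k) - beta * pd k < F (z k.+1) ->
  v k.+1 <= v k - gamma * pd k ^+ 2.
Proof.
move=> r vV xx null; have rk := reachedS r.
have pV : pd k <= 2 * V by have := decrease_le_prox_gap r; lra.
have step := prox_step_le_decrease r.
have rV : rho * pd k <= 2 * (rho * V) by rewrite mulrCA ler_pM2l.
have rV0 : 0 <= rho * V by rewrite mulr_ge0 ?V_ge0 ?ltW.
have zx : dot (z k.+1 - x k) (z k.+1 - x k) <= 2 * V / rho.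
  by rewrite ler_pdivlMr// mulrC; apply: le_trans step pV.
have gL : 2 * dot (g k.+1) (g k.+1) + 4 * (rho * V) <= L.
  apply: (L_bound (z k.+1)); last exact: (bundle_subgrad steps r).
  have := dot_add_le (z k.+1 - x k) (x k - xstar).
  rewrite addrA subrK => /le_trans; apply.
  by rewrite lerD// ler_pM2l//; exact: center_in_ball.
apply: prox_gap_null_step => //.
- apply: le_trans (dot_add_le _ _) _.
  rewrite dotNl dotNr opprK /s /prox_subgradient dotZl dotZr.
  have : rho * (rho * dot (z k.+1 - x k) (z k.+1 - x k)) <= rho * pd k.
    by rewrite ler_pM2l.
  by lra.
- by have := dot_ge0 (g k.+1); lra.
Qed.

(** The prox gap is at most V at the start and after each descent step, and null
    steps only decrease it. *)
Lemma prox_gap_bounded {k} : reach k -> v k <= V.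
Proof.
have fresh j : reach j -> x j = z j -> v j <= V.
  move=> r xz; apply: le_trans (prox_gap_new_center r xz) _.
  rewrite ler_pdivrMr ?mulr_gt0// mulrC -mulrA.
  apply: (V_bound (z j)); last exact: (bundle_step_subgradient steps).
  by rewrite -xz; exact: center_in_ball.
elim: k => [r|k IH r].
  by apply: fresh => //; rewrite (bundle_x0 steps) (bundle_z0 steps).
have [[xz _]|[xx null]] := center_step r; first exact: fresh.
have vV := IH (reachedS r); apply: le_trans (prox_gap_null_decrease r vV xx null) _.
by apply: le_trans vV; rewrite gerBl mulr_ge0 ?gamma_ge0 ?sqr_ge0.
Qed.

Lemma prox_gap_gt {k} : reach k.+1 -> eps / 2 < v k.
Proof.
move=> r; have := decrease_le_prox_gap r; have := predicted_decrease_gt r; lra.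
Qed.

(** Divide v k.+1 <= v k - gamma * (v k)^2 by v k * v k.+1 and use
    v k.+1 <= v k; positivity needs that the method goes on after both steps. *)
Lemma inverse_prox_gap_null {k} : reach k.+2 ->
  x k.+1 = x k -> F (x k) - beta * pd k < F (z k.+1) ->
  (v k)^-1 + gamma <= (v k.+1)^-1.
Proof.
move=> r xx null; have r1 := reachedS r.
have := prox_gap_null_decrease r1 (prox_gap_bounded (reachedS r1)) xx null.
have v0 : 0 < v k by have := prox_gap_gt r1; apply: lt_trans; rewrite divr_gt0.
have v1 : 0 < v k.+1 by have := prox_gap_gt r; apply: lt_trans; rewrite divr_gt0.
have : v k ^+ 2 <= pd k ^+ 2.
  rewrite lerXn2r ?nnegrE ?prox_gap_le_decrease ?ltW//.
  exact: lt_le_trans v0 (prox_gap_le_decrease _).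
move=> /(ler_wpM2l gamma_ge0) h1 h2.
have {h1 h2} h : v k.+1 <= v k - gamma * v k ^+ 2 by lra.
have hg : v k.+1 <= v k.
  by apply: le_trans h _; rewrite gerBl mulr_ge0 ?gamma_ge0 ?sqr_ge0.
have h' : 0 <= gamma * v k * (v k - v k.+1).
  by rewrite mulr_ge0 ?subr_ge0// mulr_ge0 ?gamma_ge0// ltW.
rewrite -subr_ge0 (_ : _ - _ =
  (v k - v k.+1 - gamma * v k * v k.+1) / (v k * v k.+1)); last first.
  by field; rewrite !gt_eqF.
by apply: divr_ge0; [lra | rewrite mulr_ge0// ltW].
Qed.

Lemma descent_contraction {k} : reach k.+1 ->
  F (x k.+1) <= F (x k) - beta * pd k ->
  F (x k.+1) - F xstar <= (1 - beta * c) * (F (x k) - F xstar) /\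
  beta * eps <= F (x k) - F xstar.
Proof.
move=> r Fle; have rk := reachedS r; have [beta0 _] := andP beta_in01.
have h1 := ler_wpM2l (ltW beta0) (ltW (predicted_decrease_gt r)).
have h2 := ler_wpM2l (ltW beta0) (le_trans
  (prox_gap_ge_suboptimality rk (center_in_level_set rk)) (prox_gap_le_decrease k)).
have h3 : F xstar <= F (x k.+1) := xstar_min _.
by move: h1 h2 h3 Fle; move: (pd k) => p *; split; lra.
Qed.

Lemma stopping_accuracy {k} : stops_at F eps model x z k ->
  F (x k) - F xstar <= c^-1 * eps.
Proof.
move=> [r]; rewrite stop_testE// => pde.
have c0 : 0 < c by rewrite divr_gt0// lt_min ltr01 divr_gt0.
rewrite mulrC ler_pdivlMr// mulrC.
apply: le_trans (prox_gap_ge_suboptimality r (center_in_level_set r)) _.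
exact: le_trans (prox_gap_le_decrease k) pde.
Qed.

Lemma iteration_bound {N} : reach N.+1 -> beta * eps <= F x1 - F xstar + 1 ->
  0 < 1 - beta * c < 1 ->
  N%:R <= (ln ((F x1 - F xstar + 1) / (beta * eps)) / - ln (1 - beta * c) + 2)
          * ((gamma * (eps / 2))^-1 + 1).
Proof.
move=> r epsM q01; have [beta0 beta1] := andP beta_in01.
have reach_le k : (k <= N)%N -> reach k.+1 by move=> kN; exact: reached_le r.
apply: (@iteration_count _ (fun k => F (x k) - F xstar) v) => //.
- by rewrite !divr_gt0 ?mulr_gt0 ?exprn_gt0 ?subr_gt0.
- by rewrite divr_gt0.
- by rewrite mulr_gt0.
- by rewrite (bundle_x0 steps) lerDl.
- by move=> k /reach_le/prox_gap_gt.
move=> k kN; have r1 := reach_le _ (ltnW kN); have r2 := reach_le _ kN.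
have [[_ Fle]|[xx null]] := center_step r1.
  by left; exact: descent_contraction.
by right; rewrite xx lexx; split=> //; exact: inverse_prox_gap_null.
Qed.

End Run.

(** * Complexity of the method *)

Lemma stops_within {R : realType} {n : nat} {F : 'rV[R]_n -> R} {eps T : R}
    {model : nat -> 'rV[R]_n -> \bar R} {x z : nat -> 'rV[R]_n} :
  0 <= T ->
  (forall N, reached F eps model x z N.+1 -> N%:R <= T) ->
  exists2 k, stops_at F eps model x z k & k%:R <= T + 1.
Proof.
move=> T0 bound.
have stop : exists i, stop_test F eps model x z i.
  apply: contrapT => nostop.
  have := bound (Num.truncn T).+1; rewrite leNgt truncnS_gt => h.
  by apply/notF/h => i _; apply/negP => si; apply: nostop; exists i.
have [k sk kmin] := ex_minnP stop.
have reach j : (j <= k)%N -> reached F eps model x z j.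
  move=> jk i ij; apply/negP => /kmin; apply/negP.
  by rewrite -ltnNge; exact: leq_trans jk.
exists k; first by split=> //; exact: reach.
case: k {sk kmin} reach => [|k] reach; first by rewrite addr_ge0.
by rewrite -natr1 lerD2r; exact/bound/reach.
Qed.

(** The radius of the first subgradient bound covers the level set of x1; the
    second one covers its neighbourhood in which all trial points lie, whose
    size depends on the first bound. *)
Theorem bundle_complexity {R : realType} {n : nat} {F : 'rV[R]_n -> R}
    {x1 xstar : 'rV[R]_n} {rho beta alpha : R} :
  convex_function (E := 'rV[R]_n) setT F -> 0 < rho -> 0 < beta < 1 ->
  is_minimizer F xstar -> 0 < alpha ->
  (forall y, F y <= F x1 -> F y - F xstar >= alpha * enorm (y - xstar) ^+ 2) ->
  exists K K' eps0 : R,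
    [/\ 0 < K, 0 < K', 0 < eps0 < 1 &
      forall eps : R, 0 < eps <= eps0 -> forall model x z g,
        bundle_steps F x1 rho beta eps model x z g ->
        lower_model_run F rho eps model x z g ->
        exists k : nat,
          [/\ stops_at F eps model x z k,
              k.+1%:R <= K / eps * ln (1 / eps) &
              F (x k) - F xstar <= K' * eps]].
Proof.
move=> F_convex rho_gt0 beta_in01 Fmin alpha_gt0 growth.
have [beta0 beta1] := andP beta_in01.
pose D0 := (F x1 - F xstar) / alpha.
have [G0 G0_ge0 G0_bound] := subgradient_bounded F_convex xstar D0 Fmin.
pose V := G0 / (2 * rho).
have VE : 2 * (rho * V) = G0 by rewrite /V; field; rewrite gt_eqF.
have V_ge0 : 0 <= V by rewrite divr_ge0// mulr_ge0// ltW.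
have [G1 G1_ge0 G1_bound] :=
  subgradient_bounded F_convex xstar (2 * (2 * V / rho) + 2 * D0) Fmin.
pose L := 2 * G1 + 4 * (rho * V) + 1.
have L_gt0 : 0 < L by rewrite /L; lra.
have V_bound y h : dot (y - xstar) (y - xstar) <= D0 ->
    subdifferential F y h -> dot h h <= 2 * (rho * V).
  by rewrite VE; exact: G0_bound.
have L_bound y h :
    dot (y - xstar) (y - xstar) <= 2 * (2 * V / rho) + 2 * D0 ->
    subdifferential F y h -> 2 * dot h h + 4 * (rho * V) <= L.
  by move=> yD /(G1_bound _ _ yD); rewrite /L; lra.
pose gamma := rho * (1 - beta) ^+ 2 / (2 * L).
have gamma_gt0 : 0 < gamma.
  by rewrite !divr_gt0 ?mulr_gt0 ?exprn_gt0 ?subr_gt0.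
pose c := growth_rate rho alpha.
have c_gt0 : 0 < c by rewrite divr_gt0// lt_min ltr01 divr_gt0.
have c_lt1 : c < 1.
  by rewrite ltr_pdivrMr// mul1r (le_lt_trans (_ : _ <= 1))// ?ge_min ?lexx// ltr1n.
have q01 : 0 < 1 - beta * c < 1.
  by rewrite subr_gt0 gtrBl mulr_gt0// andbT mulr_ilt1// ltW.
pose lambda := - ln (1 - beta * c).
have lambda_gt0 : 0 < lambda by rewrite oppr_gt0 ln_lt0.
pose M := F x1 - F xstar + 1.
have M_ge1 : 1 <= M by rewrite /M lerDr subr_ge0; exact: Fmin.
pose A := (ln (M / beta) + 1) / lambda + 2.
have lnM_ge0 : 0 <= ln (M / beta).
  by rewrite ln_ge0// ler_pdivlMr// mul1r ltW// (lt_le_trans beta1).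
have A_ge0 : 0 <= A by rewrite addr_ge0// divr_ge0 ?addr_ge0// ltW.
pose B := 2 / gamma + 1.
have B_gt0 : 0 < B by rewrite addr_gt0// divr_gt0.
(* From eps <= exp (-1) it follows that 1 <= ln (1 / eps) and 1 <= 1 / eps,
   which absorbs all the lower-order terms into K. *)
exists (A * B + 2), c^-1, (expR (-1)); split.
- by rewrite ltr_wpDl// mulr_ge0// ltW.
- by rewrite invr_gt0.
- by rewrite expR_gt0 expR_lt1 ltrN10.
move=> eps /andP[eps_gt0 eps_le] model x z g steps lower.
have eps_le1 : eps <= 1.
  by apply: le_trans eps_le _; rewrite ltW// expR_lt1 ltrN10.
pose Lambda := ln (1 / eps).
have Lambda_ge1 : 1 <= Lambda.
  rewrite /Lambda div1r lnV ?posrE// lerNr -[X in _ <= X]expRK.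
  by rewrite ler_ln ?posrE// expR_gt0.
have epsM : beta * eps <= M.
  by apply: le_trans M_ge1; rewrite mulr_ile1// ltW.
pose T := (ln (M / (beta * eps)) / lambda + 2) * ((gamma * (eps / 2))^-1 + 1).
have lnE : ln (M / (beta * eps)) = ln (M / beta) + Lambda.
  have M_gt0 : 0 < M := lt_le_trans ltr01 M_ge1.
  rewrite /Lambda -lnM ?posrE ?divr_gt0//; congr ln.
  by field; rewrite !gt_eqF.
have T1_ge0 : 0 <= ln (M / (beta * eps)) / lambda + 2.
  rewrite addr_ge0// lnE divr_ge0//; last exact: ltW.
  by rewrite addr_ge0// (le_trans ler01).
have T2_ge0 : 0 <= (gamma * (eps / 2))^-1 + 1.
  by rewrite addr_ge0// invr_ge0 ltW// mulr_gt0// divr_gt0.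
have T_ge0 : 0 <= T by rewrite mulr_ge0.
have [N rN|k stopk kT] :=
  stops_within (F := F) (eps := eps) (model := model) (x := x) (z := z) T_ge0.
  exact: (iteration_bound rho_gt0 beta_in01 eps_gt0 F_convex Fmin alpha_gt0
    growth steps lower V_ge0 L_gt0 V_bound L_bound rN epsM q01).
exists k; split=> //; last first.
  exact: (stopping_accuracy rho_gt0 beta_in01 eps_gt0 F_convex alpha_gt0
    growth steps lower stopk).
have T1_le : ln (M / (beta * eps)) / lambda + 2 <= A * Lambda.
  rewrite lnE /A [leRHS]mulrDl lerD//; last by rewrite ler_peMr.
  rewrite [leRHS]mulrAC ler_pM2r ?invr_gt0// [leRHS]mulrDl mul1r lerD2r.
  by rewrite ler_peMr.
have T2_le : (gamma * (eps / 2))^-1 + 1 <= B / eps.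
  rewrite /B [leRHS]mulrDl mul1r lerD//; last by rewrite invf_ge1.
  by rewrite le_eqVlt; apply/orP; left; apply/eqP; field; rewrite !gt_eqF.
have T_le : T <= (A * B) / eps * Lambda.
  apply: le_trans (ler_pM T1_ge0 T2_ge0 T1_le T2_le) _.
  by rewrite mulrACA mulrA mulrAC.
have two_le : 2 <= 2 / eps * Lambda.
  by rewrite -mulrA ler_peMr// -[1]mulr1 ler_pM// invf_ge1.
rewrite -/Lambda 2!mulrDl; apply: le_trans (lerD T_le two_le).
by rewrite -natr1 -[2]/(1 + 1) addrA lerD2r.
Qed.

Theorem mainTheorem1 (R : realType) (n : nat) (F : 'rV[R]_n -> R)
    (x1 xstar : 'rV[R]_n) (rho beta alpha : R)
    (F_convex : convex_function (E := 'rV[R]_n) setT F)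
    (rho_gt0 : 0 < rho) (beta_in01 : 0 < beta < 1)
    (xstar_min : unique (is_minimizer F) xstar)
    (alpha_gt0 : 0 < alpha)
    (growth : forall x, F x <= F x1 ->
       F x - F xstar >= alpha * enorm (x - xstar) ^+ 2) :
  exists K K' eps0 : R,
    [/\ 0 < K, 0 < K', 0 < eps0 < 1 &
      forall eps : R, 0 < eps <= eps0 ->
        (forall (x z g : nat -> 'rV[R]_n) (J : nat -> {fset nat}),
           multicut_run F x1 rho beta eps x z g J ->
           exists k : nat,
             [/\ stops_at F eps (multicut_model F z g J) x z k,
                 k.+1%:R <= K / eps * ln (1 / eps) &
                 F (x k) - F xstar <= K' * eps]) /\
        (forall (x z g : nat -> 'rV[R]_n) (theta : nat -> R),
           aggregate_run F x1 rho beta eps x z g theta ->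
           exists k : nat,
             [/\ stops_at F eps (aggregate_model F z g theta) x z k,
                 k.+1%:R <= K / eps * ln (1 / eps) &
                 F (x k) - F xstar <= K' * eps])].
Proof.
have [K [K' [eps0 [K0 K'0 eps01 complexity]]]] :=
  bundle_complexity F_convex rho_gt0 beta_in01 xstar_min.1 alpha_gt0 growth.
exists K, K', eps0; split=> // eps eps_in; split=> x z g.
  move=> J run; apply: (complexity _ eps_in _ _ _ g).
    exact: multicut_steps run.
  exact: (multicut_lower_model rho_gt0 run).
move=> theta run; apply: (complexity _ eps_in _ _ _ g).
  exact: aggregate_steps run.
exact: (aggregate_lower_model run).
Qed.
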